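(* Let $\mathcal{M}=(E,\rho)$ be a $q$-polymatroid with denominator $\mu$. Define the map \[ r_{\rho,\mu}:\mathcal{V}(E)\longrightarrow\mathbb{N}_0,\quad V\longmapsto \min\{\mu\rho(W)+\dim V-\dim W\mid W\leq V\}. \] Then $\mathcal{Z}:=(E, r_{\rho,\mu})$ is a $q$-matroid, and the independent spaces of $\mathcal{Z}$ coincide with the $\mu$-independent spaces of $\mathcal{M}$, i.e., \[ \mathcal{I}_\mu(\mathcal{M})=\mathcal{I}(\mathcal{Z})=\{I\in\mathcal{V}(E)\mid r_{\rho,\mu}(I)=\dim I\}. \]
   Context: Throughout, $\mathbb{F}=\mathbb{F}_q$ is a finite field and $E$ is a finite-dimensional $\mathbb{F}$-vector space. $V\leq W$ means that $V$ is a subspace of $W$, and $\mathcal{V}(E)$ is the set of all subspaces of $E$. A $q$-rank function on $E$ is a map $\rho:\mathcal{V}(E)\to\mathbb{Q}_{\geq0}$ such that for all $V,W\in\mathcal{V}(E)$: (R1) $0\leq\rho(V)\leq\dim V$; (R2) $V\leq W$ implies $\rho(V)\leq\rho(W)$; (R3) $\rho(V+W)+\rho(V\cap W)\leq\rho(V)+\rho(W)$. A $q$-polymatroid on $E$ is a pair $\mathcal{M}=(E,\rho)$ with $\rho$ a $q$-rank function on $E$. A number $\mu\in\mathbb{Q}_{>0}$ is a denominator of $\mathcal{M}$ if $\mu\rho(V)\in\mathbb{N}_0$ for all $V\in\mathcal{V}(E)$. A $q$-matroid is a $q$-polymatroid whose rank function takes only integer values (equivalently, with principal, i.e. smallest,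 denominator $1$; for the zero rank function the principal denominator is declared to be $1$). Let $\mathcal{M}=(E,\rho)$ be a $q$-polymatroid with denominator $\mu$. A space $I\in\mathcal{V}(E)$ is $\mu$-independent if $\rho(J)\geq\frac{\dim J}{\mu}$ for all subspaces $J\leq I$. Set $\mathcal{I}_\mu(\mathcal{M})=\{I\in\mathcal{V}(E)\mid I \text{ is } \mu\text{-independent}\}$. For a $q$-matroid $\mathcal{Z}$, ''independent'' means $1$-independent, and $\mathcal{I}(\mathcal{Z})=\mathcal{I}_1(\mathcal{Z})$. *)

(* Defs.v *)
From HB Require Import structures.
From mathcomp Require Import all_boot all_order all_algebra.

Set Implicit Arguments.
Unset Strict Implicit.
Unset Printing Implicit Defensive.

Import Order.TTheory GRing.Theory Num.Theory.
Local Open Scope ring_scope.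

(* Over a finite field {vspace E} is a finType: MathComp represents a subspace
   by a canonical square matrix. *)
Section FiniteVspace.
Import VectorInternalTheory.
Variables (F : finFieldType) (E : vectType F).
HB.instance Definition _ := [Countable of {vspace E} by <:].
HB.instance Definition _ := [Finite of {vspace E} by <:].
End FiniteVspace.

Section QPolymatroid.
Variables (F : finFieldType) (E : vectType F).
Implicit Types (rho : {vspace E} -> rat) (mu : rat) (V W I J : {vspace E}).

(* The ground space E is carried by the type of rho, so the q-polymatroid
   (E, rho) is represented by its rank function. *)
Record is_qpolymatroid rho : Prop := IsQPolymatroid {
  qrank_bounds : forall V, 0 <= rho V <= (\dim V)%:R;
  qrank_mono : forall V W, (V <= W)%VS -> rho V <= rho W;
  qrank_submod : forall V W,
    rho (V + W)%VS + rho (V :&: W)%VS <= rho V + rho W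
}.

Definition is_denominator rho mu : Prop :=
  0 < mu /\ forall V, mu * rho V \is a Num.nat.

Definition is_qmatroid rho : Prop :=
  is_qpolymatroid rho /\ forall V, rho V \is a Num.int.

Definition mu_independent rho mu I : bool :=
  [forall J : {vspace E}, (J <= I)%VS ==> ((\dim J)%:R / mu <= rho J)].

Definition mu_independents rho mu : {set {vspace E}} :=
  [set I | mu_independent rho mu I].

Definition independents rho : {set {vspace E}} := mu_independents rho 1.

Definition rank_term rho mu V W : rat :=
  mu * rho W + (\dim V)%:R - (\dim W)%:R.

(* The default value of the iterated minimum is the term W = V, itself in the
   range, so this is the minimum over {W | W <= V}. *)
Definition induced_rank rho mu V : rat :=
  \big[Order.min/rank_term rho mu V V]_(W : {vspace E} | (W <= V)%VS)
    rank_term rho mu V W.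

End QPolymatroid.

(* Main.v *)
Require Import Defs.
From mathcomp Require Import all_boot all_order all_algebra.
From mathcomp Require Import lra.

(** The weight [mu * rho W + \dim V - \dim W] splits as [\dim V] plus a function
    of [W] alone, namely [mu * rho W - \dim W], which is submodular because
    [rho] is submodular and the dimension is modular. Minimizing a submodular
    function over the subspaces of [V] gives a submodular function of [V]: if
    [A] and [B] are minimizers for [V] and [W], then [A + B] and [A :&: B]
    compete for [V + W] and [V :&: W]. Monotonicity is proved in the same way,
    by cutting a minimizer for the larger space down to the smaller one: the
    codimension of the minimizer can only shrink, and so can its [rho].

    For independence, every competitor [W] satisfies
    [\dim V <= rank_term rho mu V W] exactly when [\dim W / mu <= rho W]. Hence
    [V] is [mu]-independent for [rho] if and only if the minimum reaches
    [\dim V] ([mu_independentE]). Since [mu]-independence passes to subspaces,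
    it is equivalent to ask this of all subspaces of [V], which is
    [1]-independence for the induced rank function
    ([independents_induced_rank]). *)

Set Implicit Arguments.
Unset Strict Implicit.
Unset Printing Implicit Defensive.

Import Order.TTheory GRing.Theory Num.Theory.
Local Open Scope ring_scope.

Section InducedRank.

Variables (F : finFieldType) (E : vectType F).
Implicit Types (rho : {vspace E} -> rat) (mu : rat) (V W I J : {vspace E}).

Lemma dimv_modular V W :
  (\dim (V + W))%:R + (\dim (V :&: W))%:R = (\dim V)%:R + (\dim W)%:R :> rat.
Proof. by rewrite -!natrD dimv_sum_cap. Qed.

Lemma induced_rank_le rho mu V W :
  (W <= V)%VS -> induced_rank rho mu V <= rank_term rho mu V W.
Proof. by move=> sWV; apply: bigmin_le_cond. Qed.

Lemma le_induced_rank rho mu V x :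
  x <= induced_rank rho mu V <->
  (forall W, (W <= V)%VS -> x <= rank_term rho mu V W).
Proof.
split=> [x_le W sWV|x_le]; first exact: le_trans x_le (induced_rank_le _ _ sWV).
by apply: le_bigmin => [|W]; apply: x_le.
Qed.

Lemma induced_rank_attained rho mu V :
  exists2 W, (W <= V)%VS & induced_rank rho mu V = rank_term rho mu V W.
Proof.
rewrite /induced_rank; elim/big_ind: _ => [|x y [A sA ->] [B sB ->]|W sWV].
- by exists V.
- by case: leP => _; [exists A | exists B].
- by exists W.
Qed.

Lemma induced_rank_nat rho mu V :
  is_denominator rho mu -> induced_rank rho mu V \is a Num.nat.
Proof.
case=> _ mu_nat; have [W sWV ->] := induced_rank_attained rho mu V.
by rewrite /rank_term -addrA -natrB ?dimvS // rpredD ?mu_nat ?natr_nat.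
Qed.

Lemma induced_rank_le_dim rho mu V :
  rho 0%VS = 0 -> induced_rank rho mu V <= (\dim V)%:R.
Proof.
move=> rho0; apply: le_trans (induced_rank_le rho mu (sub0v V)) _.
by rewrite /rank_term rho0 mulr0 dimv0 add0r subr0.
Qed.

Lemma induced_rank_mono rho mu V W :
  is_qpolymatroid rho -> 0 <= mu -> (V <= W)%VS ->
  induced_rank rho mu V <= induced_rank rho mu W.
Proof.
case=> _ mono _ mu_ge0 sVW.
have [B sBW ->] := induced_rank_attained rho mu W.
apply: le_trans (induced_rank_le rho mu (capvSl V B)) _.
have rho_le := ler_wpM2l mu_ge0 (mono _ _ (capvSr V B)).
(* By modularity this says that [V :&: B] has at most the codimension in [V]
   that [B] has in [W]. *)
have dim_le : (\dim (V + B))%:R <= (\dim W)%:R :> rat.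
  by rewrite ler_nat dimvS // subv_add sVW.
by have := dimv_modular V B; rewrite /rank_term; lra.
Qed.

Lemma induced_rank_submod rho mu V W :
  is_qpolymatroid rho -> 0 <= mu ->
  induced_rank rho mu (V + W)%VS + induced_rank rho mu (V :&: W)%VS
    <= induced_rank rho mu V + induced_rank rho mu W.
Proof.
case=> _ _ submod mu_ge0.
have [A sAV ->] := induced_rank_attained rho mu V.
have [B sBW ->] := induced_rank_attained rho mu W.
have le_add := induced_rank_le rho mu (addvS sAV sBW).
have le_cap := induced_rank_le rho mu (capvS sAV sBW).
have rho_le := ler_wpM2l mu_ge0 (submod A B).
have dimAB := dimv_modular A B; have dimVW := dimv_modular V W.
by move: le_add le_cap rho_le; rewrite !mulrDr /rank_term; lra.
Qed.

Lemma qpolymatroid_rank0 rho : is_qpolymatroid rho -> rho 0%VS = 0.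
Proof.
by case=> bounds _ _; have := bounds 0%VS; rewrite dimv0 -eq_le => /eqP.
Qed.

Lemma induced_rank_qmatroid rho mu :
  is_qpolymatroid rho -> is_denominator rho mu ->
  is_qmatroid (induced_rank rho mu).
Proof.
move=> rhoP muP; have mu_ge0 : 0 <= mu by case: muP => /ltW.
split=> [|V]; last exact/intr_nat/induced_rank_nat.
split=> [V|V W|V W].
- by rewrite natr_ge0 ?induced_rank_nat // induced_rank_le_dim ?qpolymatroid_rank0.
- exact: induced_rank_mono.
- exact: induced_rank_submod.
Qed.

(** Adding [\dim I - \dim J] to both sides turns [\dim J <= mu * rho J] into
    [\dim I <= rank_term rho mu I J], a bound uniform in [J] that the minimum
    can express. *)
Lemma mu_independentE rho mu I :
  0 < mu -> mu_independent rho mu I = ((\dim I)%:R <= induced_rank rho mu I).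
Proof.
move=> mu_gt0.
have termE J : ((\dim J)%:R / mu <= rho J)
    = ((\dim I)%:R <= rank_term rho mu I J).
  by rewrite ler_pdivrMr // mulrC /rank_term; apply/idP/idP; lra.
apply/forallP/idP => [indep|/le_induced_rank le_dim J].
  by apply/le_induced_rank => J sJI; rewrite -termE; apply: (implyP (indep J)).
by apply/implyP => sJI; rewrite termE le_dim.
Qed.

Lemma mu_independentS rho mu I J :
  (J <= I)%VS -> mu_independent rho mu I -> mu_independent rho mu J.
Proof.
move=> sJI /forallP indep; apply/forallP => K; apply/implyP => sKJ.
exact: implyP (indep K) (subv_trans sKJ sJI).
Qed.

Lemma independents_induced_rank rho mu :
  0 < mu -> independents (induced_rank rho mu) = mu_independents rho mu.
Proof.
move=> mu_gt0; apply/setP => I; rewrite !inE.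
apply/forallP/idP => [indep|indep J].
  by have /implyP := indep I; rewrite divr1 subvv mu_independentE // => ->.
apply/implyP => sJI; rewrite divr1 -mu_independentE //.
exact: mu_independentS indep.
Qed.

End InducedRank.

Theorem theorem3p9 (F : finFieldType) (E : vectType F)
    (rho : {vspace E} -> rat) (mu : rat)
    (rho_qpolymatroid : is_qpolymatroid rho)
    (mu_denominator : is_denominator rho mu) :
  let r := induced_rank rho mu in
  [/\ forall V : {vspace E}, r V \is a Num.nat,
      is_qmatroid r,
      mu_independents rho mu = independents r
    & independents r = [set I : {vspace E} | r I == (\dim I)%:R]].
Proof.
have [mu_gt0 _] := mu_denominator.
split=> [V|||]; first exact: induced_rank_nat.
- exact: induced_rank_qmatroid.
- by rewrite independents_induced_rank.
rewrite independents_induced_rank //; apply/setP => I.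
by rewrite !inE mu_independentE // eq_le induced_rank_le_dim ?qpolymatroid_rank0.
Qed.
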